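(* Let $K>1$ be real and let $\varepsilon\in\mathbb{C}$ with $|\varepsilon|=1$. Then $$\beta(f_{K,\varepsilon})=\frac{1}{A(K,\varepsilon)},$$ where $A(K,\varepsilon)=\max_{|z|=1}|k_{K,\varepsilon}(z)|$. Consequently, for every choice of $(K,\varepsilon)$ with $K>1$ and $|\varepsilon|=1$ one has $B\ge 1/A(K,\varepsilon)$.
   Context: For $K>1$ and $\varepsilon\in\mathbb{C}$ with $|\varepsilon|=1$, define for every $n\in\mathbb{Z}$: $A_n:=\varepsilon^{n(n-1)/2}K^{-n(n+1)/2}$. Let $f_{K,\varepsilon}(z):=\sum_{n=0}^{\infty}A_nz^n$ (a transcendental entire function) and $k_{K,\varepsilon}(z):=\sum_{n\in\mathbb{Z}}A_nz^n$ (a Laurent series holomorphic on $\mathbb{C}\setminus\{0\}$). For an entire function $f(z)=\sum_{n\ge0}a_nz^n$ and $r>0$ put $M(r,f):=\max_{|z|=r}|f(z)|$ and $\mu(r,f):=\max_{n\ge 0}|a_n|r^n$. For transcendental entire $f$ (entire and not a polynomial) define $\beta(f):=\liminf_{r\to\infty}\mu(r,f)/M(r,f)$, and let $B:=\sup\{\beta(f): f\text{ is transcendental entire}\}$. *)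

(* Defs.v *)
From Stdlib Require Import Reals ZArith.
From Coquelicot Require Import Coquelicot.

Open Scope R_scope.

(* Definite descriptions are made with Coquelicot's [iota], as for [RInt]:
   [iota P] is the unique object satisfying [P] when there is exactly one. *)

Definition is_maximum (E : R -> Prop) (m : R) : Prop :=
  E m /\ is_upper_bound E m.

Definition maximum (E : R -> Prop) : R := iota (is_maximum E).

Definition Rbar_LimInf_p_infty (g : R -> R) : Rbar :=
  Rbar_lub (fun v => exists r0 : R,
    v = Glb_Rbar (fun y => exists r : R, r0 < r /\ y = g r)).

Definition CSeries (u : nat -> C) : C :=
  iota (T := C_CompleteNormedModule) (fun l : C => @is_series C_AbsRing C_NormedModule u l).

Definition CpowZ (z : C) (n : Z) : C :=
  match n with
  | Z0 => 1%C
  | Zpos p => Cpow z (Pos.to_nat p)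
  | Zneg p => Cinv (Cpow z (Pos.to_nat p))
  end.

Definition CSeriesZ (u : Z -> C) : C :=
  Cplus (CSeries (fun n : nat => u (Z.of_nat n)))
        (CSeries (fun n : nat => u (- Z.of_nat (S n))%Z)).

Definition entire (f : C -> C) : Prop :=
  forall z : C, @ex_derive C_AbsRing C_NormedModule f z.

Definition polynomial (f : C -> C) : Prop :=
  exists (p : nat -> C) (d : nat), forall z : C,
    f z = sum_n (fun n => Cmult (p n) (Cpow z n)) d.

Definition transcendental_entire (f : C -> C) : Prop :=
  entire f /\ ~ polynomial f.

Definition is_expansion (a : nat -> C) (f : C -> C) : Prop :=
  forall z : C,
    @is_series C_AbsRing C_NormedModule
      (fun n => Cmult (a n) (Cpow z n)) (f z).

Definition coef (f : C -> C) (n : nat) : C :=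
  iota (T := C_CompleteNormedModule)
    (fun c : C => exists a : nat -> C, is_expansion a f /\ c = a n).

Definition max_modulus (r : R) (f : C -> C) : R :=
  maximum (fun y => exists z : C, Cmod z = r /\ y = Cmod (f z)).

Definition max_term (r : R) (f : C -> C) : R :=
  maximum (fun y => exists n : nat, y = Cmod (coef f n) * r ^ n).

Definition beta (f : C -> C) : Rbar :=
  Rbar_LimInf_p_infty (fun r => max_term r f / max_modulus r f).

Definition B : Rbar :=
  Rbar_lub (fun b => exists f : C -> C, transcendental_entire f /\ b = beta f).

(* Both integer divisions are exact, n (n - 1) and n (n + 1) being even. *)
Definition A_coef (K : R) (eps : C) (n : Z) : C :=
  Cmult (CpowZ eps (n * (n - 1) / 2)) (CpowZ (RtoC K) (- (n * (n + 1) / 2))).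

Definition f_fun (K : R) (eps : C) (z : C) : C :=
  CSeries (fun n : nat => Cmult (A_coef K eps (Z.of_nat n)) (Cpow z n)).

Definition k_fun (K : R) (eps : C) (z : C) : C :=
  CSeriesZ (fun n : Z => Cmult (A_coef K eps n) (CpowZ z n)).

Definition A_max (K : R) (eps : C) : R := max_modulus 1 (k_fun K eps).

(* Main.v *)
(* For [|z| = K^N] and [w = eps^N K^(-N) z], the relation
   [A_(n+N) = A_n A_N (eps^N K^(-N))^n] gives
   [f z = A_N z^N * sum_(n >= -N) A_n w^n], and the sum tends to [k w] uniformly on [|w| = 1].
   For [K^N <= r <= K^(N+1)] the maximal term is [|A_N| r^N], so [M(r) / mu(r)] is close to
   [max |k|] at the endpoints, and Hadamard's three circles theorem, applied to [f z / z^N],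
   shows that it is not essentially larger in between.  That theorem is obtained for polynomials
   without complex integration: coefficients are bounded by averaging over roots of unity, and
   the number of coefficients, which grows linearly in [m] for [f^m], disappears under [m]-th
   roots. *)

Require Import Defs.
From Stdlib Require Import Reals ZArith Lra Lia.
From Coquelicot Require Import Coquelicot.

(** * Polynomials *)

(** The definite descriptions [CSeries], [coef] and [maximum] carry information only once existence
    and uniqueness are known, so absolute convergence, uniqueness of expansions and continuity on
    circles have to be established as well. Uniqueness of the coefficients comes from the same
    average over roots of unity, used with the bound 0.

    The Laurent series [k] gets no theory of its own: it is split as f(w) + g(1/w) - 1 with f and g
    entire, and all analysis is done for entire expansions.

    Three circles is needed only for bounds M |z|^s with a natural exponent s and the same M on both
    circles. This is enough because the terms of index N and N + 1 have equal modulus on |z| =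
    K^(N+1): the estimate there, which belongs to N + 1, is also the one for s = N with the constant
    of the inner circle. Intermediate radii matter only for bounding the lower limit from below; the
    radii K^N alone bound it from above. *)

Definition csum (u : nat -> C) (d : nat) : C := @sum_n C_AbelianMonoid u d.

Lemma csum_O (u : nat -> C) : csum u 0 = u 0%nat.
Proof. exact (sum_O (G := C_AbelianMonoid) u). Qed.

Lemma csum_S (u : nat -> C) (d : nat) : csum u (S d) = (csum u d + u (S d))%C.
Proof. exact (sum_Sn (G := C_AbelianMonoid) u d). Qed.

Lemma csum_ext (u v : nat -> C) (d : nat) :
  (forall n, (n <= d)%nat -> u n = v n) -> csum u d = csum v d.
Proof. exact (sum_n_ext_loc (G := C_AbelianMonoid) u v d). Qed.

Lemma csum_plus (u v : nat -> C) (d : nat) :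
  csum (fun n => u n + v n)%C d = (csum u d + csum v d)%C.
Proof. exact (sum_n_plus (G := C_AbelianMonoid) u v d). Qed.

Lemma csum_mult_l (c : C) (u : nat -> C) (d : nat) :
  csum (fun n => c * u n)%C d = (c * csum u d)%C.
Proof. exact (sum_n_mult_l (K := C_Ring) c u d). Qed.

Lemma csum_mult_r (c : C) (u : nat -> C) (d : nat) :
  csum (fun n => u n * c)%C d = (csum u d * c)%C.
Proof. exact (sum_n_mult_r (K := C_Ring) c u d). Qed.

Lemma csum_zero (u : nat -> C) (d : nat) :
  (forall n, (n <= d)%nat -> u n = 0%C) -> csum u d = 0%C.
Proof.
  intros H. induction d as [|d IH].
  - rewrite csum_O. apply H; lia.
  - rewrite csum_S, IH, H; [ring|lia|]. intros; apply H; lia.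
Qed.

Lemma csum_single (u : nat -> C) (d m : nat) :
  (m <= d)%nat -> (forall n, (n <= d)%nat -> n <> m -> u n = 0%C) -> csum u d = u m.
Proof.
  induction d as [|d IH]; intros Hm H.
  - rewrite csum_O. f_equal; lia.
  - rewrite csum_S. destruct (Nat.eq_dec m (S d)) as [->|Hne].
    + rewrite csum_zero; [ring|]. intros n Hn. apply H; lia.
    + rewrite IH, (H (S d)); [ring|lia|lia|lia|]. intros n Hn; apply H; lia.
Qed.

Lemma Cmod_csum_le (u : nat -> C) (d : nat) :
  Cmod (csum u d) <= sum_n (fun n => Cmod (u n)) d.
Proof. exact (norm_sum_n_m (V := C_NormedModule) u 0 d). Qed.

Lemma sum_n_const_bound (u : nat -> R) (d : nat) (b : R) :
  (forall n, (n <= d)%nat -> u n <= b) -> sum_n u d <= INR (S d) * b.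
Proof.
  induction d as [|d IH]; intros H.
  - rewrite sum_O. simpl. rewrite Rmult_1_l. apply H; lia.
  - rewrite sum_Sn, S_INR. change plus with Rplus.
    assert (sum_n u d <= INR (S d) * b) by (apply IH; intros; apply H; lia).
    assert (u (S d) <= b) by (apply H; lia). lra.
Qed.

(** * Roots of unity and the coefficient bound *)

Definition cis (t : R) : C := (cos t, sin t).

Lemma cis_plus (s t : R) : cis (s + t) = (cis s * cis t)%C.
Proof.
  unfold cis, Cmult; simpl. rewrite cos_plus, sin_plus. f_equal; ring.
Qed.

Lemma cis_pow (t : R) (n : nat) : (cis t ^ n)%C = cis (INR n * t).
Proof.
  induction n as [|n IH].
  - simpl. unfold cis. rewrite Rmult_0_l, cos_0, sin_0. reflexivity.
  - rewrite Cpow_S, IH, <- cis_plus, S_INR. f_equal; ring.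
Qed.

Lemma Cmod_cis (t : R) : Cmod (cis t) = 1.
Proof.
  unfold Cmod, cis; simpl. transitivity (sqrt 1); [f_equal|apply sqrt_1].
  generalize (sin2_cos2 t). unfold Rsqr. lra.
Qed.

(** cos t = 1 - 2 sin(t/2)^2, and t/2 lies in (0, pi), where the sine is positive. *)
Lemma cis_eq_1 (t : R) : 0 < t < 2 * PI -> cis t <> 1%C.
Proof.
  intros [H0 H1] E.
  assert (Hc : cos t = 1) by (exact (f_equal fst E)).
  replace t with (2 * (t / 2)) in Hc by field.
  rewrite cos_2a_sin in Hc.
  assert (0 < sin (t / 2)) by (apply sin_gt_0; lra).
  set (s := sin (t / 2)) in *. clearbody s. assert (0 < s * s) by (apply Rmult_lt_0_compat; lra). lra.
Qed.

Lemma geometric_sum_root_of_unity (x : C) (d : nat) :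
  (x ^ S d = 1)%C -> x <> 1%C -> csum (fun j => x ^ j)%C d = 0%C.
Proof.
  intros H1 Hn.
  assert (E : ((x - 1) * csum (fun j => x ^ j)%C d = x ^ S d - 1)%C).
  { clear. induction d as [|d IH].
    - rewrite csum_O. simpl. ring.
    - rewrite csum_S, (Cpow_S x (S d)), Cmult_plus_distr_l, IH. ring. }
  rewrite H1 in E. apply Cmod_eq_0.
  apply (f_equal Cmod) in E. rewrite Cmod_mult in E.
  replace (1 - 1)%C with (RtoC 0) in E by ring. rewrite Cmod_0 in E.
  destruct (Rmult_integral _ _ E) as [H|H]; trivial.
  exfalso; apply Hn. apply Cmod_eq_0 in H.
  replace x with (x - 1 + 1)%C by ring. rewrite H. ring.
Qed.

Definition psum (a : nat -> C) (d : nat) (z : C) : C := csum (fun n => a n * z ^ n)%C d.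

(** The exponent n - m of the averaging argument is replaced by e = n + (d + 1 - m) to stay in
    [nat]. For n, m <= d it lies strictly between 0 and 2 (d + 1), and it is a multiple of the order
    d + 1 only when n = m. *)
Lemma root_of_unity_sum (d e : nat) :
  (0 < e < 2 * S d)%nat -> e <> S d ->
  csum (fun j => (cis (2 * PI / INR (S d)) ^ e) ^ j)%C d = 0%C.
Proof.
  intros He Hne. set (w := cis _).
  assert (HN : 0 < INR (S d)) by (apply lt_0_INR; lia).
  assert (Hpi := PI_RGT_0).
  assert (Hw : (w ^ S d = 1)%C).
  { unfold w. rewrite cis_pow. replace (INR (S d) * (2 * PI / INR (S d))) with (2 * PI) by (field; lra).
    unfold cis. now rewrite cos_2PI, sin_2PI. }
  assert (Hlt : forall k, (0 < k < S d)%nat -> (w ^ k <> 1)%C).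
  { intros k Hk. unfold w. rewrite cis_pow. apply cis_eq_1.
    assert (0 < INR k) by (apply lt_0_INR; lia).
    assert (INR k < INR (S d)) by (apply lt_INR; lia).
    replace (INR k * (2 * PI / INR (S d))) with (2 * PI * (INR k / INR (S d))) by (field; lra).
    assert (0 < INR k / INR (S d)) by (apply Rdiv_lt_0_compat; lra).
    assert (INR k / INR (S d) < 1) by (apply Rlt_div_l; lra).
    nra. }
  apply geometric_sum_root_of_unity.
  - rewrite <- Cpow_mult_r, Nat.mul_comm, Cpow_mult_r, Hw. apply Cpow_1_l.
  - destruct (Nat.lt_ge_cases e (S d)) as [H|H].
    + apply Hlt; lia.
    + replace e with (S d + (e - S d))%nat by lia.
      rewrite Cpow_add_r, Hw, Cmult_1_l. apply Hlt; lia.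
Qed.

Lemma csum_const (c : C) (d : nat) : csum (fun _ => c) d = (RtoC (INR (S d)) * c)%C.
Proof.
  induction d as [|d IH].
  - rewrite csum_O. simpl. ring.
  - rewrite csum_S, IH, (S_INR (S d)), RtoC_plus. ring.
Qed.

(* Averaging [P (r w^j) w^(-m j)] over the powers of a root of unity [w] of order [d + 1]
   isolates the coefficient of index [m]. *)
Lemma poly_coef_bound (p : nat -> C) (d : nat) (r M : R) :
  0 <= r -> (forall z, Cmod z = r -> Cmod (psum p d z) <= M) ->
  forall m, (m <= d)%nat -> Cmod (p m) * r ^ m <= M.
Proof.
  intros Hr HM m Hm.
  set (w := cis (2 * PI / INR (S d))).
  assert (HN : 0 < INR (S d)) by (apply lt_0_INR; lia).
  assert (E : csum (fun j => psum p d (r * w ^ j) * (w ^ (S d - m)) ^ j)%C d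
              = (RtoC (INR (S d)) * (p m * r ^ m))%C).
  { transitivity (csum (fun j => csum (fun n => (p n * r ^ n) * (w ^ (n + (S d - m))) ^ j)%C d) d).
    { apply csum_ext. intros j _. unfold psum. rewrite <- csum_mult_r.
      apply csum_ext. intros n _.
      rewrite Cpow_mult_l, Cpow_add_r, Cpow_mult_l, <- !Cpow_mult_r, (Nat.mul_comm j n). ring. }
    transitivity (csum (fun n => csum (fun j => (p n * r ^ n) * (w ^ (n + (S d - m))) ^ j)%C d) d).
    { exact (sum_n_switch (G := C_AbelianMonoid) _ d d). }
    rewrite (csum_single _ d m Hm).
    - rewrite <- csum_const. apply csum_ext. intros j _.
      replace (m + (S d - m))%nat with (S d) by lia.
      unfold w. rewrite cis_pow. replace (INR (S d) * (2 * PI / INR (S d))) with (2 * PI) by (field; lra).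
      unfold cis. rewrite cos_2PI, sin_2PI. change (1, 0) with (RtoC 1). rewrite Cpow_1_l. ring.
    - intros n Hn Hne. rewrite csum_mult_l. unfold w. rewrite root_of_unity_sum; [ring|lia|lia]. }
  apply (f_equal Cmod) in E. rewrite !Cmod_mult, Cmod_R, (Rabs_pos_eq (INR (S d))) in E by lra.
  rewrite <- RtoC_pow, Cmod_R, (Rabs_pos_eq (r ^ m)) in E by (apply pow_le; lra).
  apply Rmult_le_reg_l with (INR (S d)); [lra|]. rewrite <- E.
  eapply Rle_trans; [apply Cmod_csum_le|]. apply sum_n_const_bound.
  intros j _. rewrite Cmod_mult, !Cmod_pow. unfold w; rewrite Cmod_cis, !pow1, Rmult_1_r.
  apply HM. rewrite Cmod_mult, Cmod_pow, Cmod_cis, pow1, Cmod_R, Rabs_pos_eq; lra.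
Qed.

(** * Polynomials with a tracked degree bound *)

Definition polynomial_upto (d : nat) (f : C -> C) : Prop :=
  exists p, forall z, f z = psum p d z.

Lemma polynomial_upto_weaken (d e : nat) (f : C -> C) :
  (d <= e)%nat -> polynomial_upto d f -> polynomial_upto e f.
Proof.
  intros Hle [p Hp]. exists (fun n => if le_dec n d then p n else 0%C).
  intros z. rewrite Hp. unfold psum.
  induction Hle as [|e Hle IH].
  - apply csum_ext. intros n Hn. destruct (le_dec n d); [trivial|lia].
  - rewrite csum_S, <- IH. destruct (le_dec (S e) d); [lia|ring].
Qed.

Lemma polynomial_upto_plus (d : nat) (f g : C -> C) :
  polynomial_upto d f -> polynomial_upto d g -> polynomial_upto d (fun z => f z + g z)%C.
Proof.
  intros [p Hp] [q Hq]. exists (fun n => p n + q n)%C. intros z.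
  rewrite Hp, Hq. unfold psum. rewrite <- csum_plus. apply csum_ext; intros; ring.
Qed.

Lemma polynomial_upto_monomial_mult (d k : nat) (c : C) (f : C -> C) :
  polynomial_upto d f -> polynomial_upto (d + k) (fun z => c * z ^ k * f z)%C.
Proof.
  intros [p Hp]. exists (fun n => if le_dec k n then c * p (n - k)%nat else 0)%C.
  intros z. rewrite Hp. unfold psum. clear Hp. induction d as [|d IH].
  - rewrite (csum_single _ (0 + k) k); [|lia|].
    + rewrite csum_O. destruct (le_dec k k); [|lia]. rewrite Nat.sub_diag. simpl; ring.
    + intros n Hn Hne. destruct (le_dec k n); [lia|ring].
  - change (S d + k)%nat with (S (d + k)). rewrite !csum_S, <- IH.
    destruct (le_dec k (S (d + k))); [|lia].
    replace (S (d + k) - k)%nat with (S d) by lia.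
    replace (S (d + k)) with (k + S d)%nat by lia.
    rewrite (Cpow_add_r z k). ring.
Qed.

(** Peeling the leading monomial off [f] avoids convolutions: only the number of coefficients of a
    product is ever used, not their values. *)
Lemma polynomial_upto_mult (d e : nat) (f g : C -> C) :
  polynomial_upto d f -> polynomial_upto e g -> polynomial_upto (e + d) (fun z => f z * g z)%C.
Proof.
  intros [p Hp] Hg. revert f Hp. induction d as [|d IH]; intros f Hp.
  - destruct (polynomial_upto_monomial_mult e 0 (p 0%nat) g Hg) as [q Hq].
    exists q. intros z. rewrite <- Hq, Hp. unfold psum. now rewrite csum_O.
  - destruct (polynomial_upto_plus (e + S d) (fun z => psum p d z * g z)%C
      (fun z => p (S d) * z ^ S d * g z)%C) as [q Hq].
    + apply polynomial_upto_weaken with (e + d)%nat; [lia|]. now apply IH.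
    + now apply polynomial_upto_monomial_mult.
    + exists q. intros z. rewrite <- Hq, Hp. unfold psum. rewrite csum_S. ring.
Qed.

Lemma polynomial_upto_pow (d m : nat) (f : C -> C) :
  polynomial_upto d f -> polynomial_upto (m * d) (fun z => f z ^ m)%C.
Proof.
  intros Hf. induction m as [|m IH].
  - exists (fun _ => 1%C). intros z. unfold psum. simpl. rewrite csum_O. simpl. ring.
  - replace (S m * d)%nat with (m * d + d)%nat by (simpl; lia).
    apply (polynomial_upto_mult d (m * d) f _ Hf IH).
Qed.

(** If x = (1 + h) y with h > 0, then (1 + h)^m would grow at most linearly. Bernoulli's inequality
    is itself only linear, so it is applied to exponent k + 1 and squared; the resulting quadratic
    lower bound contradicts the case m = 2 (k + 1). *)
Lemma le_of_pow_le_linear (x y : R) (d : nat) :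
  0 <= x -> 0 <= y -> (forall m, x ^ m <= INR (S (m * d)) * y ^ m) -> x <= y.
Proof.
  intros Hx Hy H. destruct (Rle_lt_dec x y) as [|Hlt]; trivial. exfalso.
  destruct (Req_dec y 0) as [->|Hy0].
  { specialize (H 1%nat). rewrite !pow_1, Rmult_0_r in H. lra. }
  assert (Hyp : 0 < y) by lra.
  set (h := x / y - 1).
  assert (Hh : 0 < h).
  { unfold h. assert (1 < x / y) by (apply Rlt_div_r; lra). lra. }
  assert (Hm : forall m, (1 + h) ^ m <= INR (S (m * d))).
  { intros m. unfold h. replace (1 + (x / y - 1)) with (x / y) by ring.
    unfold Rdiv. rewrite Rpow_mult_distr, pow_inv.
    assert (Hym : 0 < y ^ m) by (apply pow_lt; lra).
    apply Rle_div_l; [lra|]. apply H. }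
  (* This choice gives (k + 1) h^2 > 2 d, so the quadratic term (k + 1)^2 h^2 exceeds the linear
     bound 2 (k + 1) d. *)
  destruct (nfloor_ex (2 * INR d / (h * h))) as [k [_ Hk]].
  { apply Rdiv_le_0_compat; [|nra]. generalize (pos_INR d); lra. }
  assert (Hb := poly (S k) h Hh).
  assert (Hm2 : ((1 + h) ^ S k) ^ 2 <= 2 * (INR k + 1) * INR d + 1).
  { rewrite <- pow_mult. eapply Rle_trans; [apply Hm|].
    rewrite S_INR, !mult_INR, S_INR. simpl. lra. }
  rewrite S_INR in Hb. apply Rlt_div_l in Hk; [|nra].
  set (t := INR k) in *. assert (0 <= t) by apply pos_INR.
  assert (Hsq : (1 + (t + 1) * h) ^ 2 <= ((1 + h) ^ S k) ^ 2) by (apply pow_incr; nra).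
  assert (0 < (t + 1) * ((t + 1) * (h * h) - 2 * INR d)) by (apply Rmult_lt_0_compat; lra).
  assert (0 < (t + 1) * h) by (apply Rmult_lt_0_compat; lra).
  nra.
Qed.

(* The coefficient bound for [f^m] costs only the factor [m d + 1], which [le_of_pow_le_linear]
   removes. *)
Lemma poly_two_circles (d s : nat) (f : C -> C) (r1 r2 M : R) :
  polynomial_upto d f -> 0 < r1 -> 0 <= M ->
  (forall z, Cmod z = r1 \/ Cmod z = r2 -> Cmod (f z) <= M * Cmod z ^ s) ->
  forall z, r1 <= Cmod z <= r2 -> Cmod (f z) <= M * Cmod z ^ s.
Proof.
  intros Hf Hr1 HM H z Hz. set (r := Cmod z) in *.
  assert (Hy : forall t, 0 <= t -> 0 <= M * t ^ s).
  { intros t Ht. apply Rmult_le_pos; trivial. now apply pow_le. }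
  apply (le_of_pow_le_linear _ _ d); [apply Cmod_ge_0|apply Hy; lra|].
  intros m. destruct (polynomial_upto_pow d m f Hf) as [p Hp].
  assert (Hc : forall ri, ri = r1 \/ ri = r2 ->
     forall n, (n <= m * d)%nat -> Cmod (p n) * ri ^ n <= (M * ri ^ s) ^ m).
  { intros ri Hri. assert (Hri0 : 0 < ri) by (destruct Hri; lra).
    apply poly_coef_bound; [lra|]. intros x Hx. rewrite <- Hp, Cmod_pow.
    apply pow_incr. split; [apply Cmod_ge_0|]. rewrite <- Hx. apply H. rewrite Hx; tauto. }
  rewrite <- Cmod_pow, Hp. eapply Rle_trans; [apply Cmod_csum_le|].
  apply sum_n_const_bound. intros n Hn. rewrite Cmod_mult, Cmod_pow. fold r.
  assert (Hsplit : forall t, (M * t ^ s) ^ m = M ^ m * t ^ (s * m)).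
  { intros t. now rewrite Rpow_mult_distr, pow_mult. }
  assert (Hr : 0 < r) by lra.
  (* After division by t^(s m) the term of index n varies as t^(n - s m): it decreases in t for n <=
     s m, where the inner circle controls it, and increases otherwise, where the outer one does. *)
  destruct (Nat.le_gt_cases n (s * m)) as [Hns|Hns].
  - specialize (Hc r1 (or_introl eq_refl) n Hn). rewrite Hsplit in *.
    replace (s * m)%nat with (n + (s * m - n))%nat in * by lia.
    rewrite pow_add in *.
    assert (0 < r1 ^ n) by (apply pow_lt; lra).
    assert (Cmod (p n) <= M ^ m * r1 ^ (s * m - n)).
    { apply Rmult_le_reg_r with (r1 ^ n); lra. }
    assert (r1 ^ (s * m - n) <= r ^ (s * m - n)) by (apply pow_incr; lra).
    assert (0 <= M ^ m) by now apply pow_le.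
    assert (0 < r ^ n) by (apply pow_lt; lra).
    assert (Cmod (p n) <= M ^ m * r ^ (s * m - n)) by nra.
    nra.
  - specialize (Hc r2 (or_intror eq_refl) n Hn). rewrite Hsplit in *.
    replace n with (s * m + (n - s * m))%nat at 2 by lia.
    replace n with (s * m + (n - s * m))%nat in Hc at 2 by lia.
    rewrite pow_add in *.
    assert (0 < r2 ^ (s * m)) by (apply pow_lt; lra).
    assert (Cmod (p n) * r2 ^ (n - s * m) <= M ^ m).
    { apply Rmult_le_reg_r with (r2 ^ (s * m)); lra. }
    assert (r ^ (n - s * m) <= r2 ^ (n - s * m)) by (apply pow_incr; lra).
    assert (0 <= Cmod (p n)) by apply Cmod_ge_0.
    assert (0 < r ^ (s * m)) by (apply pow_lt; lra).
    assert (Cmod (p n) * r ^ (n - s * m) <= M ^ m) by nra.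
    nra.
Qed.

(** * Entire power series *)

Definition is_cseries (u : nat -> C) (l : C) : Prop := @is_series C_AbsRing C_NormedModule u l.

Lemma is_cseries_eps (u : nat -> C) (l : C) :
  is_cseries u l <->
  forall eta, 0 < eta -> exists N, forall n, (N <= n)%nat -> Cmod (csum u n - l) < eta.
Proof.
  unfold is_cseries, is_series.
  rewrite (filterlim_locally_ball_norm (K := C_AbsRing) (U := C_NormedModule)).
  split; intros H.
  - intros eta Heta. exact (H (mkposreal eta Heta)).
  - intros eta. exact (H eta (cond_pos eta)).
Qed.

(** The Weierstrass M-test: [N] is chosen before [u], from the majorant alone. This is what later
    makes convergence uniform in z. *)
Lemma csum_tail (b : nat -> R) (eta : R) :
  ex_series b -> 0 < eta ->
  exists N, forall u, (forall n, Cmod (u n) <= b n) ->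
    forall d m, (N <= d <= m)%nat -> Cmod (csum u m - csum u d) <= eta.
Proof.
  intros Hb Heta.
  destruct (Cauchy_ex_series (V := R_CompleteNormedModule) b Hb (mkposreal eta Heta)) as [N HN].
  exists N. intros u Hu d m [Hd Hm]. simpl in HN.
  replace (csum u m - csum u d)%C with (sum_n_m (G := C_AbelianMonoid) u (S d) m)
    by exact (sum_n_m_sum_n (G := C_NormedModule) u d m Hm).
  eapply Rle_trans; [exact (norm_sum_n_m (V := C_NormedModule) u (S d) m)|].
  apply Rle_trans with (sum_n_m b (S d) m); [now apply sum_n_m_le|].
  left. eapply Rle_lt_trans; [|apply (HN (S d) m); lia].
  apply Rle_abs.
Qed.

Lemma cseries_tail (b : nat -> R) (eta : R) :
  ex_series b -> 0 < eta ->
  exists N, forall u l, is_cseries u l -> (forall n, Cmod (u n) <= b n) ->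
    forall d, (N <= d)%nat -> Cmod (l - csum u d) <= eta.
Proof.
  intros Hb Heta. destruct (csum_tail b eta Hb Heta) as [N HN].
  exists N. intros u l Hl Hu d Hd. apply le_epsilon. intros e He.
  destruct (proj1 (is_cseries_eps u l) Hl e He) as [N' HN'].
  specialize (HN' (N' + d)%nat ltac:(lia)).
  specialize (HN u Hu d (N' + d)%nat ltac:(lia)).
  replace (l - csum u d)%C with
    ((csum u (N' + d) - csum u d) + - (csum u (N' + d) - l))%C by ring.
  eapply Rle_trans; [apply Cmod_triangle|]. rewrite Cmod_opp. lra.
Qed.

Lemma is_cseries_Cmod_le (u : nat -> C) (l : C) (b : nat -> R) (s : R) :
  is_cseries u l -> (forall n, Cmod (u n) <= b n) -> is_series b s -> Cmod l <= s.
Proof.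
  intros Hl Hu Hb. apply le_epsilon. intros e He.
  destruct (proj1 (is_cseries_eps u l) Hl e He) as [N HN].
  specialize (HN N (le_n N)).
  replace l with (csum u N + - (csum u N - l))%C by ring.
  eapply Rle_trans; [apply Cmod_triangle|]. rewrite Cmod_opp.
  enough (Cmod (csum u N) <= s) by lra.
  eapply Rle_trans; [apply Cmod_csum_le|].
  apply Rle_trans with (sum_n b N); [now apply sum_n_m_le|].
  apply (is_lim_seq_incr_compare (sum_n b) s Hb).
  intros n. rewrite sum_Sn. change plus with Rplus.
  generalize (Hu (S n)) (Cmod_ge_0 (u (S n))). lra.
Qed.

Lemma ex_cseries_le (u : nat -> C) (b : nat -> R) :
  (forall n, Cmod (u n) <= b n) -> ex_series b -> exists l, is_cseries u l.
Proof. exact (ex_series_le (V := C_CompleteNormedModule) u b). Qed.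

Lemma is_cseries_unique (u : nat -> C) (l l' : C) :
  is_cseries u l -> is_cseries u l' -> l = l'.
Proof.
  intros H H'. enough (Hd : Cmod (l - l') <= 0).
  { assert (E : (l - l' = 0)%C) by (apply Cmod_eq_0; generalize (Cmod_ge_0 (l - l')); lra).
    replace l with (l - l' + l')%C by ring. rewrite E. ring. }
  apply le_epsilon. intros e He.
  destruct (proj1 (is_cseries_eps u l) H (e / 2) ltac:(lra)) as [N HN].
  destruct (proj1 (is_cseries_eps u l') H' (e / 2) ltac:(lra)) as [N' HN'].
  specialize (HN (N + N')%nat ltac:(lia)). specialize (HN' (N + N')%nat ltac:(lia)).
  replace (l - l')%C with ((csum u (N + N') - l') + - (csum u (N + N') - l))%C by ring.
  eapply Rle_trans; [apply Cmod_triangle|]. rewrite Cmod_opp. lra.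
Qed.

Lemma CSeries_unique (u : nat -> C) (l : C) : is_cseries u l -> CSeries u = l.
Proof.
  intros H. unfold CSeries.
  apply (iota_unique (V := C_CompleteNormedModule)); [|exact H].
  intros y Hy. exact (is_cseries_unique u y l Hy H).
Qed.

(** * Coefficients of everywhere convergent expansions *)

Definition entire_coefs (a : nat -> C) : Prop :=
  forall r, 0 <= r -> ex_series (fun n => Cmod (a n) * r ^ n).

(** At the real point x = 2 r + 1 a term is the difference of two consecutive partial sums, hence
    eventually at most 2. As r <= x / 2, the terms at r are dominated by a geometric series of ratio
    1/2. *)
Lemma is_expansion_entire_coefs (a : nat -> C) (f : C -> C) :
  is_expansion a f -> entire_coefs a.
Proof.
  intros Hf r Hr. set (x := 2 * r + 1).
  assert (Hb : exists M N, forall n, (N <= n)%nat -> Cmod (a n) * x ^ n <= M).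
  { destruct (proj1 (is_cseries_eps _ _) (Hf (RtoC x)) 1 Rlt_0_1) as [N HN].
    exists 2, (S N). intros n Hn. destruct n as [|n]; [lia|].
    assert (H1 := HN n ltac:(lia)). assert (H2 := HN (S n) ltac:(lia)).
    rewrite csum_S in H2. set (s := csum _ n) in *. set (l := f _) in *.
    replace (Cmod (a (S n)) * x ^ S n) with (Cmod (a (S n) * x ^ S n)%C).
    - replace (a (S n) * x ^ S n)%C with ((s + a (S n) * x ^ S n - l) + - (s - l))%C by ring.
      eapply Rle_trans; [apply Cmod_triangle|]. rewrite Cmod_opp. lra.
    - rewrite Cmod_mult, <- RtoC_pow, Cmod_R, Rabs_pos_eq; trivial.
      apply pow_le. unfold x; lra. }
  destruct Hb as [M [N HN]].
  apply (ex_series_incr_n (fun n => Cmod (a n) * r ^ n) N).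
  apply (ex_series_le (V := R_CompleteNormedModule) _ (fun k => M * (/ 2) ^ (N + k))).
  - intros k. specialize (HN (N + k)%nat ltac:(lia)). set (n := (N + k)%nat) in *.
    change (norm ?y) with (Rabs y).
    assert (Hrn : 0 <= r ^ n) by now apply pow_le.
    assert (Ha := Cmod_ge_0 (a n)).
    rewrite Rabs_pos_eq by now apply Rmult_le_pos.
    assert (Hx : r ^ n <= x ^ n * (/ 2) ^ n).
    { rewrite <- Rpow_mult_distr. apply pow_incr. unfold x; lra. }
    assert (0 < (/ 2) ^ n) by (apply pow_lt; lra).
    apply Rle_trans with (Cmod (a n) * (x ^ n * (/ 2) ^ n)); [now apply Rmult_le_compat_l|].
    rewrite <- Rmult_assoc. apply Rmult_le_compat_r; lra.
  - apply (ex_series_scal_l (K := R_AbsRing) (V := R_NormedModule) M).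
    apply (ex_series_incr_n (fun n => (/ 2) ^ n) N).
    apply ex_series_geom. rewrite Rabs_pos_eq; lra.
Qed.

Lemma entire_coefs_expansion (a : nat -> C) :
  entire_coefs a -> is_expansion a (fun z => CSeries (fun n => a n * z ^ n)%C).
Proof.
  intros Ha z.
  destruct (ex_cseries_le (fun n => a n * z ^ n)%C (fun n => Cmod (a n) * Cmod z ^ n)) as [l Hl].
  - intros n. rewrite Cmod_mult, Cmod_pow. lra.
  - apply Ha, Cmod_ge_0.
  - rewrite (CSeries_unique _ l Hl). exact Hl.
Qed.

Lemma expansion_unif (a : nat -> C) (f : C -> C) (r eta : R) :
  is_expansion a f -> 0 <= r -> 0 < eta ->
  exists N, forall d z, (N <= d)%nat -> Cmod z <= r -> Cmod (f z - psum a d z) <= eta.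
Proof.
  intros Hf Hr Heta.
  destruct (cseries_tail _ eta (is_expansion_entire_coefs a f Hf r Hr) Heta) as [N HN].
  exists N. intros d z Hd Hz. apply HN; trivial; [apply Hf|].
  intros n. rewrite Cmod_mult, Cmod_pow. apply Rmult_le_compat_l; [apply Cmod_ge_0|].
  apply pow_incr. split; [apply Cmod_ge_0|trivial].
Qed.

(** Partial sums are uniformly close to [f] on the circle, so the polynomial bound passes to the
    limit. Truncating at [N + n] ensures that the index [n] is present. *)
Lemma Cauchy_estimate (a : nat -> C) (f : C -> C) (r M : R) :
  is_expansion a f -> 0 <= r -> (forall z, Cmod z = r -> Cmod (f z) <= M) ->
  forall n, Cmod (a n) * r ^ n <= M.
Proof.
  intros Hf Hr HM n. apply le_epsilon. intros e He.
  destruct (expansion_unif a f r e Hf Hr He) as [N HN].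
  apply (poly_coef_bound a (N + n)); [trivial| |lia].
  intros z Hz. specialize (HN (N + n)%nat z ltac:(lia) ltac:(lra)). specialize (HM z Hz).
  replace (psum a (N + n) z) with (f z + - (f z - psum a (N + n) z))%C by ring.
  eapply Rle_trans; [apply Cmod_triangle|]. rewrite Cmod_opp. lra.
Qed.

(** The difference expands the zero function, and the Cauchy estimate with bound 0 on the unit
    circle annihilates its coefficients. *)
Lemma is_expansion_unique (a b : nat -> C) (f : C -> C) :
  is_expansion a f -> is_expansion b f -> forall n, a n = b n.
Proof.
  intros Ha Hb n.
  assert (Hd : is_expansion (fun n => a n - b n)%C (fun _ => 0%C)).
  { intros z. apply is_series_ext with (fun n => minus (G := C_NormedModule) (a n * z ^ n)%C (b n * z ^ n)%C).
    - intros k. change (a k * z ^ k - b k * z ^ k = (a k - b k) * z ^ k)%C. ring.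
    - replace (RtoC 0) with (minus (G := C_NormedModule) (f z) (f z)).
      + apply is_series_minus; [apply Ha|apply Hb].
      + change (f z - f z = 0)%C. ring. }
  assert (H := Cauchy_estimate _ _ 1 0 Hd Rle_0_1
    ltac:(intros; cbv beta; rewrite Cmod_0; lra) n).
  rewrite pow1, Rmult_1_r in H.
  assert (E : (a n - b n = 0)%C) by (apply Cmod_eq_0; generalize (Cmod_ge_0 (a n - b n)); lra).
  replace (a n) with (a n - b n + b n)%C by ring. rewrite E. ring.
Qed.

Lemma coef_expansion (a : nat -> C) (f : C -> C) (n : nat) : is_expansion a f -> coef f n = a n.
Proof.
  intros Ha. unfold coef. apply (iota_unique (V := C_CompleteNormedModule)).
  - intros y [b [Hb ->]]. now apply (is_expansion_unique b a f).
  - now exists a.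
Qed.

(** The polynomial case is applied to a partial sum. A truncation error below [eta * r1 ^ s] is
    below eta |x|^s on the whole annulus, so it has the shape of the bound and only enlarges [M] to
    [M + eta]. *)
Lemma expansion_two_circles (a : nat -> C) (f : C -> C) (s : nat) (r1 r2 M : R) :
  is_expansion a f -> 0 < r1 -> 0 <= M ->
  (forall z, Cmod z = r1 \/ Cmod z = r2 -> Cmod (f z) <= M * Cmod z ^ s) ->
  forall z, r1 <= Cmod z <= r2 -> Cmod (f z) <= M * Cmod z ^ s.
Proof.
  intros Hf Hr1 HM H z Hz.
  assert (Hzs : 0 < Cmod z ^ s) by (apply pow_lt; lra).
  apply le_epsilon. intros e He.
  (* Half of [e], because the truncation error counts twice: in [M + eta] and in the return from the
     partial sum to [f]. *)
  set (eta := e / 2 / Cmod z ^ s).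
  assert (Heta : 0 < eta) by (unfold eta; apply Rdiv_lt_0_compat; lra).
  assert (Hr1s : 0 < r1 ^ s) by (apply pow_lt; lra).
  destruct (expansion_unif a f r2 (eta * r1 ^ s) Hf ltac:(lra)) as [N HN]; [nra|].
  assert (HN' : forall x, r1 <= Cmod x <= r2 -> Cmod (f x - psum a N x) <= eta * Cmod x ^ s).
  { intros x Hx. eapply Rle_trans; [apply HN; [lia|lra]|].
    apply Rmult_le_compat_l; [lra|]. apply pow_incr; lra. }
  assert (Hp : Cmod (psum a N z) <= (M + eta) * Cmod z ^ s).
  { apply (poly_two_circles N s _ r1 r2); trivial; [now exists a|lra|].
    intros x Hx. assert (Hx' : r1 <= Cmod x <= r2) by (destruct Hx; lra).
    specialize (HN' x Hx'). specialize (H x Hx).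
    replace (psum a N x) with (f x + - (f x - psum a N x))%C by ring.
    eapply Rle_trans; [apply Cmod_triangle|]. rewrite Cmod_opp. lra. }
  specialize (HN' z Hz).
  replace (f z) with (psum a N z + (f z - psum a N z))%C by ring.
  eapply Rle_trans; [apply Cmod_triangle|].
  assert (eta * Cmod z ^ s = e / 2) by (unfold eta; field; lra). lra.
Qed.

(** * Differentiability and continuity of expansions *)

Lemma pow_second_order (z h : C) (r : R) (n : nat) :
  Cmod z + 1 <= r -> Cmod h <= 1 ->
  Cmod ((z + h) ^ S n - z ^ S n - h * (RtoC (INR (S n)) * z ^ n))
    <= Cmod h ^ 2 * ((2 * r) ^ 2) ^ S n.
Proof.
  intros Hr Hh. assert (Hz := Cmod_ge_0 z). assert (Hh0 := Cmod_ge_0 h).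
  assert (Hzh : Cmod (z + h) <= r) by (generalize (Cmod_triangle z h); lra).
  (* With e_n the remainder for exponent n, e_(n+1) = (z + h) e_n + h^2 n z^(n-1); the quadratic
     factor survives the induction because k^2 + k <= (k + 1)^2. *)
  assert (Hstrong : Cmod ((z + h) ^ S n - z ^ S n - h * (RtoC (INR (S n)) * z ^ n))
    <= Cmod h ^ 2 * (INR (S n) ^ 2 * r ^ S n)).
  { induction n as [|n IH].
    - replace ((z + h) ^ 1 - z ^ 1 - h * (RtoC (INR 1) * z ^ 0))%C with (RtoC 0).
      + rewrite Cmod_0. simpl. nra.
      + simpl. ring.
    - set (e := ((z + h) ^ S n - z ^ S n - h * (RtoC (INR (S n)) * z ^ n))%C) in *.
      replace ((z + h) ^ S (S n) - z ^ S (S n) - h * (RtoC (INR (S (S n))) * z ^ S n))%C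
        with ((z + h) * e + h ^ 2 * (RtoC (INR (S n)) * z ^ n))%C.
      + eapply Rle_trans; [apply Cmod_triangle|].
        rewrite !Cmod_mult, !Cmod_pow, Cmod_R, (Rabs_pos_eq _ (pos_INR _)).
        assert (Hzn : Cmod z ^ n <= r ^ n) by (apply pow_incr; lra).
        assert (Hrn : 0 < r ^ n) by (apply pow_lt; lra).
        assert (HS := pos_INR (S n)). rewrite (S_INR (S n)).
        set (k := INR (S n)) in *. set (H2 := Cmod h ^ 2) in *.
        assert (0 <= H2) by (apply pow_le; lra).
        assert (Cmod (z + h) * Cmod e <= r * (H2 * (k ^ 2 * r ^ S n))).
        { apply Rmult_le_compat; trivial; apply Cmod_ge_0. }
        assert (H2 * (k * Cmod z ^ n) <= H2 * (k * r ^ S (S n))).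
        { apply Rmult_le_compat_l; trivial. apply Rmult_le_compat_l; trivial.
          simpl. assert (Hr1 : 1 <= r * r) by nra.
          apply Rmult_le_compat_r with (r := r ^ n) in Hr1; lra. }
        replace (r ^ S (S n)) with (r * r ^ S n) in * by reflexivity.
        assert (0 < r ^ S n) by (apply pow_lt; lra).
        set (q := r * r ^ S n) in *. assert (0 < q) by (unfold q; nra).
        replace (r * (H2 * (k ^ 2 * r ^ S n))) with (H2 * (k ^ 2 * q)) in * by (unfold q; ring).
        assert (0 <= H2 * q * (k + 1)) by (apply Rmult_le_pos; nra).
        nra.
      + unfold e. rewrite (S_INR (S n)), RtoC_plus. simpl. ring. }
  (* The factor n^2 is absorbed through n <= 2^n, leaving a pure power that can be summed against
     the coefficients at radius (2 r)^2. *)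
  eapply Rle_trans; [exact Hstrong|].
  apply Rmult_le_compat_l; [now apply pow_le|].
  rewrite <- pow_mult, (Nat.mul_comm 2), pow_mult, Rpow_mult_distr, Rpow_mult_distr.
  assert (INR (S n) <= 2 ^ S n).
  { replace 2 with (INR 2) by (simpl; lra). rewrite <- pow_INR. apply le_INR. apply Nat.lt_le_incl, Nat.pow_gt_lin_r; lia. }
  assert (H0 := pos_INR (S n)).
  assert (1 <= r ^ S n) by (apply pow_R1_Rle; lra).
  assert (INR (S n) ^ 2 <= (2 ^ S n) ^ 2) by (apply pow_incr; lra).
  assert (0 <= INR (S n) ^ 2) by nra.
  apply Rmult_le_compat; nra.
Qed.

(** Termwise differentiation with a quantitative remainder; both complex differentiability and
    continuity follow from it. *)
Lemma expansion_second_order (a : nat -> C) (f : C -> C) (z : C) :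
  is_expansion a f ->
  exists D M, 0 <= M /\
    forall h, Cmod h <= 1 -> Cmod (f (z + h) - f z - h * D)%C <= M * Cmod h ^ 2.
Proof.
  intros Hf. assert (Ha := is_expansion_entire_coefs a f Hf).
  set (r := Cmod z + 1). assert (Hz := Cmod_ge_0 z).
  set (b := fun n => Cmod (a n) * ((2 * r) ^ 2) ^ n).
  assert (Hb : ex_series b) by (apply Ha, pow2_ge_0).
  assert (Hb0 : forall n, 0 <= b n).
  { intros n. apply Rmult_le_pos; [apply Cmod_ge_0|]. apply pow_le, pow2_ge_0. }
  (* Derivatives of z^n kept at index n, with 0 at n = 0, so that the derived series lines up term
     by term with those of f(z + h) and f(z). *)
  set (dz := fun n => match n return C with O => 0%C | S k => (RtoC (INR (S k)) * z ^ k)%C end).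
  assert (Hdz : forall n, Cmod (dz n) <= ((2 * r) ^ 2) ^ n).
  { intros [|k]; [change (dz 0%nat) with (RtoC 0); rewrite Cmod_0; simpl; lra|].
    change (dz (S k)) with (RtoC (INR (S k)) * z ^ k)%C.
    rewrite Cmod_mult, Cmod_pow, Cmod_R, (Rabs_pos_eq _ (pos_INR _)).
    assert (INR (S k) <= 2 ^ S k).
    { replace 2 with (INR 2) by (simpl; lra). rewrite <- pow_INR. apply le_INR. apply Nat.lt_le_incl, Nat.pow_gt_lin_r; lia. }
    assert (Cmod z ^ k <= r ^ S k).
    { apply Rle_trans with (r ^ k); [apply pow_incr; unfold r; lra|].
      apply Rle_pow; [unfold r; lra|lia]. }
    assert (HSk := pos_INR (S k)). assert (0 <= Cmod z ^ k) by now apply pow_le.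
    apply Rle_trans with ((2 * r) ^ S k).
    - rewrite Rpow_mult_distr. now apply Rmult_le_compat.
    - apply pow_incr. unfold r. nra. }
  destruct (ex_cseries_le (fun n => a n * dz n)%C b) as [D HD]; trivial.
  { intros n. rewrite Cmod_mult. apply Rmult_le_compat_l; [apply Cmod_ge_0|trivial]. }
  destruct Hb as [M HM]. change (is_series b M) in HM.
  exists D, M. split.
  { apply Rle_trans with (Cmod D); [apply Cmod_ge_0|].
    apply (is_cseries_Cmod_le _ D b M HD); trivial.
    intros n. rewrite Cmod_mult. apply Rmult_le_compat_l; [apply Cmod_ge_0|trivial]. }
  intros h Hh.
  apply (is_cseries_Cmod_le (fun n => a n * (z + h) ^ n - a n * z ^ n - h * (a n * dz n))%C _
    (fun n => b n * Cmod h ^ 2)).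
  - change (is_series (fun n => minus (G := C_NormedModule)
       (minus (G := C_NormedModule) (a n * (z + h) ^ n)%C (a n * z ^ n)%C)
       (scal (V := C_NormedModule) h (a n * dz n)%C))
       (minus (G := C_NormedModule) (minus (G := C_NormedModule) (f (z + h)%C) (f z))
         (scal (V := C_NormedModule) h D))).
    apply (is_series_minus (V := C_NormedModule)).
    + apply (is_series_minus (V := C_NormedModule)); apply Hf.
    + now apply (is_series_scal (V := C_NormedModule)).
  - intros n.
    replace (a n * (z + h) ^ n - a n * z ^ n - h * (a n * dz n))%C
      with (a n * ((z + h) ^ n - z ^ n - h * dz n))%C by ring.
    rewrite Cmod_mult. unfold b. rewrite Rmult_assoc.
    apply Rmult_le_compat_l; [apply Cmod_ge_0|]. rewrite Rmult_comm.
    destruct n as [|n].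
    + replace ((z + h) ^ 0 - z ^ 0 - h * dz 0%nat)%C with (RtoC 0) by (simpl; ring).
      rewrite Cmod_0. apply Rmult_le_pos; [apply pow2_ge_0|simpl; lra].
    + apply pow_second_order; unfold r; lra.
  - now apply is_series_scal_r.
Qed.

Lemma expansion_entire (a : nat -> C) (f : C -> C) : is_expansion a f -> entire f.
Proof.
  intros Hf z. destruct (expansion_second_order a f z Hf) as [D [M [HM H]]].
  exists D. split; [apply is_linear_scal_l|].
  intros x Hx. apply (is_filter_lim_locally_unique (V := AbsRing_NormedModule C_AbsRing)) in Hx.
  subst x. intros eps.
  assert (Hd : 0 < Rmin 1 (eps / (M + 1))).
  { apply Rmin_pos; [lra|]. apply Rdiv_lt_0_compat; [apply cond_pos|lra]. }
  exists (mkposreal _ Hd). intros y Hy.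
  change (Cmod (y - z) < Rmin 1 (eps / (M + 1))) in Hy.
  change (Cmod (f y - f z - (y - z) * D) <= eps * Cmod (y - z)).
  assert (H1 := Rmin_l 1 (eps / (M + 1))). assert (H2 := Rmin_r 1 (eps / (M + 1))).
  assert (H3 : Cmod (y - z) < eps / (M + 1)) by lra. apply Rlt_div_r in H3; [|lra].
  specialize (H (y - z)%C ltac:(lra)).
  assert (E : forall u v : C, (u + (v - u) = v)%C) by (intros; ring).
  rewrite (E z y) in H.
  eapply Rle_trans; [exact H|]. assert (H0 := Cmod_ge_0 (y - z)). nra.
Qed.

Definition continuous_eps (f : C -> C) : Prop :=
  forall z eta, 0 < eta ->
    exists delta, 0 < delta /\ forall w, Cmod (w - z) < delta -> Cmod (f w - f z) < eta.

Lemma expansion_continuous (a : nat -> C) (f : C -> C) : is_expansion a f -> continuous_eps f.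
Proof.
  intros Hf z eta Heta. destruct (expansion_second_order a f z Hf) as [D [M [HM H]]].
  assert (HD := Cmod_ge_0 D).
  exists (Rmin 1 (eta / (M + Cmod D + 1))). split.
  { apply Rmin_pos; [lra|]. apply Rdiv_lt_0_compat; lra. }
  intros w Hw.
  assert (H1 := Rmin_l 1 (eta / (M + Cmod D + 1))). assert (H2 := Rmin_r 1 (eta / (M + Cmod D + 1))).
  assert (H3 : Cmod (w - z) < eta / (M + Cmod D + 1)) by lra. apply Rlt_div_r in H3; [|lra].
  specialize (H (w - z)%C ltac:(lra)).
  replace (z + (w - z))%C with w in H by ring.
  assert (H0 := Cmod_ge_0 (w - z)).
  replace (f w - f z)%C with ((f w - f z - (w - z) * D) + (w - z) * D)%C by ring.
  eapply Rle_lt_trans; [apply Cmod_triangle|]. rewrite Cmod_mult.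
  set (x := Cmod (w - z)) in *.
  assert (x * (M * x) <= x * (M * 1)).
  { apply Rmult_le_compat_l; trivial. apply Rmult_le_compat_l; lra. }
  simpl in H. nra.
Qed.

(** * Maxima on circles *)

Lemma polar_form (z : C) (r : R) : Cmod z = r -> exists t, - PI <= t <= PI /\ z = (r * cis t)%C.
Proof.
  intros Hz. assert (Hpi := PI_RGT_0).
  assert (Hr : 0 <= r) by (rewrite <- Hz; apply Cmod_ge_0).
  destruct (Req_dec r 0) as [H0|H0].
  { exists 0. split; [lra|]. rewrite H0 in *. rewrite (Cmod_eq_0 z Hz). ring. }
  destruct z as [x y].
  assert (E : x * x + y * y = r * r).
  { unfold Cmod in Hz; simpl in Hz. rewrite <- Hz, sqrt_sqrt; [ring|nra]. }
  assert (Hx : -1 <= x / r <= 1).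
  { split; [apply Rle_div_r|apply Rle_div_l]; nra. }
  assert (Hs : sqrt (1 - (x / r)²) = Rabs y / r).
  { replace (1 - (x / r)²) with ((y / r)²).
    - rewrite sqrt_Rsqr_abs, Rabs_div, (Rabs_pos_eq r) by lra. reflexivity.
    - unfold Rsqr. replace (x / r * (x / r)) with ((r * r - y * y) / (r * r)).
      + field; lra.
      + replace (r * r - y * y) with (x * x) by lra. field; lra. }
  assert (Hb := acos_bound (x / r)).
  assert (Hc := cos_acos _ Hx). assert (Hsn := sin_acos _ Hx). rewrite Hs in Hsn.
  destruct (Rle_lt_dec 0 y) as [Hy|Hy].
  - exists (acos (x / r)). split; [lra|].
    rewrite Rabs_pos_eq in Hsn by lra.
    unfold cis, Cmult, RtoC; simpl. rewrite Hc, Hsn. f_equal; field; lra.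
  - exists (- acos (x / r)). split; [lra|].
    rewrite Rabs_left in Hsn by lra.
    unfold cis, Cmult, RtoC; simpl. rewrite cos_neg, sin_neg, Hc, Hsn. f_equal; field; lra.
Qed.

Lemma cis_continuous (t eta : R) :
  0 < eta -> exists delta, 0 < delta /\
    forall s, Rabs (s - t) < delta -> Cmod (cis s - cis t) < eta.
Proof.
  intros Heta.
  destruct (continuity_cos t (eta / 2) ltac:(lra)) as [d1 [Hd1 H1]].
  destruct (continuity_sin t (eta / 2) ltac:(lra)) as [d2 [Hd2 H2]].
  exists (Rmin d1 d2). split; [now apply Rmin_pos|]. intros s Hs.
  assert (Hl := Rmin_l d1 d2). assert (Hr := Rmin_r d1 d2).
  replace (cis s - cis t)%C with (RtoC (cos s - cos t) + Ci * RtoC (sin s - sin t))%C.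
  2: { apply injective_projections; simpl; ring. }
  eapply Rle_lt_trans; [apply Cmod_triangle|].
  rewrite Cmod_mult, Cmod_Ci, !Cmod_R, Rmult_1_l.
  (* The standard notion of continuity speaks only of points other than [t], so [s = t] is treated
     apart. *)
  destruct (Req_dec t s) as [->|Hne].
  { rewrite !Rminus_diag, Rabs_R0. lra. }
  specialize (H1 s). specialize (H2 s). simpl in H1, H2. unfold R_dist, Rdist, D_x, no_cond in H1, H2.
  assert (Rabs (cos s - cos t) < eta / 2) by (apply H1; repeat split; trivial; lra).
  assert (Rabs (sin s - sin t) < eta / 2) by (apply H2; repeat split; trivial; lra).
  lra.
Qed.

(** Polar angles reduce this to the extreme value theorem on [-pi, pi]. Continuity is asked only
    along the circle because the lemma must also cover the Laurent series [k_fun]. *)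
Lemma circle_maximum (f : C -> C) (r : R) :
  0 <= r ->
  (forall t eta, 0 < eta -> exists delta, 0 < delta /\
     forall s, Rabs (s - t) < delta -> Cmod (f (r * cis s) - f (r * cis t))%C < eta) ->
  exists m, is_maximum (fun y => exists z, Cmod z = r /\ y = Cmod (f z)) m.
Proof.
  intros Hr Hf. assert (Hpi := PI_RGT_0).
  destruct (continuity_ab_maj (fun t => Cmod (f (r * cis t)%C)) (- PI) PI) as [t [Hmax Ht]].
  - lra.
  - intros t _ eta Heta. destruct (Hf t eta Heta) as [d [Hd H]].
    exists d. split; [exact Hd|]. intros s [_ Hs]. simpl in *. unfold Rdist in *.
    eapply Rle_lt_trans; [|apply (H s Hs)].
    set (u := f (r * cis s)%C). set (v := f (r * cis t)%C).
    assert (Ht1 := Cmod_triangle (u - v) v). assert (Ht2 := Cmod_triangle (v - u) u).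
    replace (u - v + v)%C with u in Ht1 by ring. replace (v - u + u)%C with v in Ht2 by ring.
    replace (v - u)%C with (- (u - v))%C in Ht2 by ring. rewrite Cmod_opp in Ht2.
    apply Rabs_le. lra.
  - exists (Cmod (f (r * cis t)%C)). split.
    + exists (r * cis t)%C. split; trivial.
      rewrite Cmod_mult, Cmod_cis, Cmod_R, Rabs_pos_eq; lra.
    + intros y [z [Hz ->]]. destruct (polar_form z r Hz) as [s [Hs ->]]. now apply Hmax.
Qed.

Lemma maximum_unique (E : R -> Prop) (m : R) : is_maximum E m -> maximum E = m.
Proof.
  intros H. unfold maximum. apply (iota_unique (V := R_CompleteNormedModule)); [|exact H].
  intros y [Hy Hyb]. destruct H as [Hm Hmb]. apply Rle_antisym; [now apply Hmb|now apply Hyb].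
Qed.

Lemma expansion_max_modulus (a : nat -> C) (f : C -> C) (r : R) :
  is_expansion a f -> 0 <= r ->
  is_maximum (fun y => exists z, Cmod z = r /\ y = Cmod (f z)) (max_modulus r f).
Proof.
  intros Hf Hr. destruct (circle_maximum f r Hr) as [m Hm].
  - intros t eta Heta.
    destruct (expansion_continuous a f Hf (r * cis t)%C eta Heta) as [d [Hd H]].
    destruct (cis_continuous t (d / (r + 1))) as [d' [Hd' H']].
    { apply Rdiv_lt_0_compat; lra. }
    exists d'. split; trivial. intros s Hs. apply H.
    replace (r * cis s - r * cis t)%C with (r * (cis s - cis t))%C by ring.
    rewrite Cmod_mult, Cmod_R, Rabs_pos_eq by trivial.
    specialize (H' s Hs). apply Rlt_div_r in H'; [|lra].
    generalize (Cmod_ge_0 (cis s - cis t)). nra.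
  - unfold max_modulus. now rewrite (maximum_unique _ m Hm).
Qed.

(** * The extremal functions *)

Lemma CpowZ_of_nat (z : C) (n : nat) : CpowZ z (Z.of_nat n) = (z ^ n)%C.
Proof.
  destruct n as [|n]; [reflexivity|].
  change (Z.of_nat (S n)) with (Zpos (Pos.of_succ_nat n)). unfold CpowZ.
  now rewrite SuccNat2Pos.id_succ.
Qed.

Lemma CpowZ_opp_of_nat (z : C) (n : nat) : CpowZ z (- Z.of_nat n) = (/ z ^ n)%C.
Proof.
  destruct n as [|n]; [simpl; field; apply C1_nz|].
  change (- Z.of_nat (S n))%Z with (Zneg (Pos.of_succ_nat n)). unfold CpowZ.
  now rewrite SuccNat2Pos.id_succ.
Qed.

(** Every integer is a difference of naturals; in this form the addition law needs no case analysis
    on signs. *)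
Lemma CpowZ_sub_of_nat (z : C) (a b : nat) :
  z <> 0%C -> CpowZ z (Z.of_nat a - Z.of_nat b) = (z ^ a * / z ^ b)%C.
Proof.
  intros Hz. destruct (Nat.le_ge_cases a b) as [H|H].
  - replace (Z.of_nat a - Z.of_nat b)%Z with (- Z.of_nat (b - a))%Z by lia.
    rewrite CpowZ_opp_of_nat. replace b with (a + (b - a))%nat at 2 by lia.
    rewrite Cpow_add_r. field. split; now apply Cpow_nz.
  - replace (Z.of_nat a - Z.of_nat b)%Z with (Z.of_nat (a - b)) by lia.
    rewrite CpowZ_of_nat. replace a with (b + (a - b))%nat at 2 by lia.
    rewrite Cpow_add_r. field. now apply Cpow_nz.
Qed.

Lemma CpowZ_add (z : C) (m n : Z) :
  z <> 0%C -> CpowZ z (m + n) = (CpowZ z m * CpowZ z n)%C.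
Proof.
  intros Hz.
  assert (Hd : forall k, exists a b, k = (Z.of_nat a - Z.of_nat b)%Z).
  { intros k. exists (Z.to_nat k), (Z.to_nat (- k)). lia. }
  destruct (Hd m) as [a [b ->]]. destruct (Hd n) as [c [d ->]].
  replace (Z.of_nat a - Z.of_nat b + (Z.of_nat c - Z.of_nat d))%Z
    with (Z.of_nat (a + c) - Z.of_nat (b + d))%Z by lia.
  rewrite !CpowZ_sub_of_nat, !Cpow_add_r by trivial.
  field. split; now apply Cpow_nz.
Qed.

(** Doubling removes the integer division, so identities between exponents become polynomial. *)
Lemma half_product_pred (n : Z) : (2 * (n * (n - 1) / 2) = n * (n - 1))%Z.
Proof.
  destruct (Z.Even_or_Odd n) as [[k ->]|[k ->]].
  - replace (2 * k * (2 * k - 1))%Z with (k * (2 * k - 1) * 2)%Z by ring.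
    rewrite Z.div_mul; lia.
  - replace ((2 * k + 1) * (2 * k + 1 - 1))%Z with ((2 * k + 1) * k * 2)%Z by ring.
    rewrite Z.div_mul; lia.
Qed.

Lemma half_product_succ (n : Z) : (2 * (n * (n + 1) / 2) = n * (n + 1))%Z.
Proof.
  generalize (half_product_pred (n + 1)).
  replace ((n + 1) * (n + 1 - 1))%Z with (n * (n + 1))%Z by ring. trivial.
Qed.

(** Both exponents are quadratic with leading coefficient 1/2 up to sign, so each is additive up to
    the cross term a b. Over [Z] the law serves both for shifting an index up and for reflecting it
    below N. *)
Lemma A_coef_add (K : R) (eps : C) (a b : Z) : RtoC K <> 0%C -> eps <> 0%C ->
  A_coef K eps (a + b) =
  (A_coef K eps a * A_coef K eps b * (CpowZ eps (a * b) * CpowZ K (- (a * b))))%C.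
Proof.
  intros HK He. unfold A_coef.
  replace ((a + b) * (a + b - 1) / 2)%Z
    with (a * (a - 1) / 2 + b * (b - 1) / 2 + a * b)%Z.
  2: { generalize (half_product_pred (a + b)) (half_product_pred a) (half_product_pred b). nia. }
  replace (- ((a + b) * (a + b + 1) / 2))%Z
    with (- (a * (a + 1) / 2) + - (b * (b + 1) / 2) + - (a * b))%Z.
  2: { generalize (half_product_succ (a + b)) (half_product_succ a) (half_product_succ b). nia. }
  rewrite !CpowZ_add by trivial. ring.
Qed.

(** The ratio test requires nonzero terms, hence the radius r + 1 in place of r, which may be 0. *)
Lemma entire_coefs_of_ratio (b : nat -> C) (rho : nat -> R) :
  (forall n, b n <> 0%C) -> (forall n, Cmod (b (S n)) = Cmod (b n) * rho n) ->
  is_lim_seq rho 0 -> entire_coefs b.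
Proof.
  intros Hb Hr Hlim r Hr0.
  assert (Hb' : forall n, 0 < Cmod (b n)) by (intros n; apply Cmod_gt_0, Hb).
  assert (Hp : forall n, 0 < (r + 1) ^ n) by (intros; apply pow_lt; lra).
  assert (H1 : ex_series (fun n => Rabs (Cmod (b n) * (r + 1) ^ n))).
  { apply ex_series_DAlembert with 0; [lra| |].
    - intros n. specialize (Hb' n). specialize (Hp n). nra.
    - apply is_lim_seq_ext with (fun n => Rabs (rho n * (r + 1))).
      + intros n. f_equal. rewrite Hr. specialize (Hb' n). specialize (Hp n). simpl. field. lra.
      + rewrite <- Rabs_R0. apply is_lim_seq_abs with (l := Finite 0).
        replace (Finite 0) with (Rbar_mult (Finite 0) (Finite (r + 1))) by (simpl; f_equal; ring).
        now apply is_lim_seq_scal_r. }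
  apply (ex_series_le (V := R_CompleteNormedModule) _ (fun n => Rabs (Cmod (b n) * (r + 1) ^ n)));
    [|exact H1].
  intros n. change (norm ?y) with (Rabs y). specialize (Hb' n). specialize (Hp n).
  assert (0 <= r ^ n) by now apply pow_le.
  assert (r ^ n <= (r + 1) ^ n) by (apply pow_incr; lra).
  rewrite !Rabs_pos_eq by nra. nra.
Qed.

Lemma csum_S_l (u : nat -> C) (d : nat) :
  csum u (S d) = (u 0%nat + csum (fun n => u (S n)) d)%C.
Proof.
  induction d as [|d IH].
  - rewrite csum_S, !csum_O. ring.
  - rewrite csum_S, IH, (csum_S _ d). ring.
Qed.

Lemma csum_rev (u : nat -> C) (d : nat) : csum u d = csum (fun m => u (d - m)%nat) d.
Proof.
  induction d as [|d IH].
  - now rewrite !csum_O.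
  - rewrite csum_S, csum_S_l, IH. simpl. ring.
Qed.

Lemma Rbar_LimInf_p_infty_eq (g : R -> R) (l : R) :
  (forall eta, 0 < eta -> exists r0, forall r, r0 < r -> l - eta <= g r) ->
  (forall eta r0, 0 < eta -> exists r, r0 < r /\ g r <= l + eta) ->
  Rbar_LimInf_p_infty g = Finite l.
Proof.
  intros Hlow Hup. apply Rbar_is_lub_unique. split.
  - intros v [r0 ->].
    destruct (Glb_Rbar_correct (fun y => exists r, r0 < r /\ y = g r)) as [Hlb _].
    destruct (Glb_Rbar _) as [x| |]; simpl in *; trivial.
    + apply le_epsilon. intros e He. destruct (Hup e r0 He) as [r [Hr Hg]].
      assert (x <= g r) by (apply Hlb; now exists r). lra.
    + destruct (Hup 1 r0 Rlt_0_1) as [r [Hr Hg]]. apply (Hlb (g r)). now exists r.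
  - intros b Hb.
    assert (Hb' : forall eta, 0 < eta -> Rbar_le (l - eta) b).
    { intros eta Heta. destruct (Hlow eta Heta) as [r0 Hr0].
      eapply Rbar_le_trans; [|apply Hb; now exists r0].
      apply Glb_Rbar_correct. intros y [r [Hr ->]]. now apply Hr0. }
    destruct b as [b| |]; simpl in *; trivial.
    + apply le_epsilon. intros e He. specialize (Hb' e He). lra.
    + exact (Hb' 1 Rlt_0_1).
Qed.

Lemma pow_bracket (K r : R) (N : nat) : 1 < K -> K ^ N <= r ->
  exists n, (N <= n)%nat /\ K ^ n <= r <= K ^ S n.
Proof.
  intros HK Hr.
  destruct (Pow_x_infinity K ltac:(rewrite Rabs_pos_eq; lra) (r + 1)) as [m Hm].
  specialize (Hm m (le_n m)). rewrite Rabs_pos_eq in Hm by (apply pow_le; lra).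
  assert (H : r < K ^ m) by lra. clear Hm. induction m as [|m IH].
  - exfalso. assert (1 <= K ^ N) by (apply pow_R1_Rle; lra). simpl in H. lra.
  - destruct (Rlt_le_dec r (K ^ m)) as [Hlt|Hge]; [now apply IH|].
    destruct (Nat.le_gt_cases N m) as [HNm|HNm].
    + exists m. split; [trivial|]. lra.
    + exfalso. assert (K ^ S m <= K ^ N) by (apply Rle_pow; [lra|lia]). lra.
Qed.

Section Extremal.
Variables (K : R) (eps : C).
Hypotheses (HK : 1 < K) (Heps : Cmod eps = 1).

Let a (n : nat) : C := A_coef K eps (Z.of_nat n).
Let a' (n : nat) : C := A_coef K eps (- Z.of_nat n).
Let f : C -> C := f_fun K eps.
(** [g (/ w)] collects the powers of w with exponent at most 0. The constant term 1 belongs to [f]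
    as well, whence the - 1 in [k_eq]. *)
Let g (z : C) : C := CSeries (fun n => a' n * z ^ n)%C.
Let k : C -> C := k_fun K eps.
Let A : R := A_max K eps.

Let K_neq_0 : RtoC K <> 0%C.
Proof. intros E. apply RtoC_inj in E. lra. Qed.

Let eps_neq_0 : eps <> 0%C.
Proof. apply Cmod_gt_0. lra. Qed.

Lemma Cmod_rotation (n : nat) :
  Cmod (CpowZ eps (Z.of_nat n) * CpowZ K (- Z.of_nat n)) = (/ K) ^ n.
Proof.
  rewrite CpowZ_of_nat, CpowZ_opp_of_nat, Cmod_mult, Cmod_inv by now apply Cpow_nz.
  rewrite !Cmod_pow, Heps, Cmod_R, Rabs_pos_eq, pow1, pow_inv by lra. ring.
Qed.

Lemma Cmod_A_coef_1 : Cmod (A_coef K eps 1) = / K.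
Proof.
  unfold A_coef. simpl. rewrite !Cmod_mult, Cmod_inv, Cmod_mult, Cmod_1, Cmod_R, Rabs_pos_eq.
  - field; lra.
  - lra.
  - intros E. apply K_neq_0. rewrite <- E. ring.
Qed.

Lemma Cmod_A_coef_m1 : Cmod (A_coef K eps (-1)) = 1.
Proof. unfold A_coef. simpl. rewrite !Cmod_mult, Cmod_1, Heps. ring. Qed.

Lemma a_0 : a 0 = 1%C.
Proof. unfold a, A_coef. simpl. ring. Qed.

Lemma a'_0 : a' 0 = 1%C.
Proof. unfold a', A_coef. simpl. ring. Qed.

Lemma Cmod_a_S (n : nat) : Cmod (a (S n)) = Cmod (a n) * (/ K) ^ S n.
Proof.
  unfold a. rewrite Nat2Z.inj_succ. unfold Z.succ. rewrite A_coef_add by trivial.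
  rewrite Z.mul_1_r, !(Cmod_mult (_ * _)), Cmod_mult, Cmod_rotation, Cmod_A_coef_1. simpl. ring.
Qed.

Lemma Cmod_a'_S (n : nat) : Cmod (a' (S n)) = Cmod (a' n) * (/ K) ^ n.
Proof.
  unfold a'. rewrite Nat2Z.inj_succ. replace (- Z.succ (Z.of_nat n))%Z with (- Z.of_nat n + -1)%Z by lia.
  rewrite A_coef_add by trivial.
  replace (- Z.of_nat n * -1)%Z with (Z.of_nat n) by lia.
  rewrite !(Cmod_mult (_ * _)), Cmod_mult, Cmod_rotation, Cmod_A_coef_m1. ring.
Qed.

Let inv_K_bounds : 0 < / K < 1.
Proof. split; [apply Rinv_0_lt_compat; lra|]. rewrite <- Rinv_1. apply Rinv_lt_contravar; lra. Qed.

Lemma Cmod_a_pos (n : nat) : 0 < Cmod (a n).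
Proof.
  induction n as [|n IH]; [rewrite a_0, Cmod_1; lra|].
  rewrite Cmod_a_S. apply Rmult_lt_0_compat; trivial. apply pow_lt; lra.
Qed.

Lemma Cmod_a'_pos (n : nat) : 0 < Cmod (a' n).
Proof.
  induction n as [|n IH]; [rewrite a'_0, Cmod_1; lra|].
  rewrite Cmod_a'_S. apply Rmult_lt_0_compat; trivial. apply pow_lt; lra.
Qed.

Lemma f_expansion : is_expansion a f.
Proof.
  apply entire_coefs_expansion. apply entire_coefs_of_ratio with (fun n => (/ K) ^ S n).
  - intros n. apply Cmod_gt_0, Cmod_a_pos.
  - apply Cmod_a_S.
  - apply (is_lim_seq_incr_1 (fun n => (/ K) ^ n)). apply is_lim_seq_geom. rewrite Rabs_pos_eq; lra.
Qed.

Lemma g_expansion : is_expansion a' g.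
Proof.
  apply entire_coefs_expansion. apply entire_coefs_of_ratio with (fun n => (/ K) ^ n).
  - intros n. apply Cmod_gt_0, Cmod_a'_pos.
  - apply Cmod_a'_S.
  - apply is_lim_seq_geom. rewrite Rabs_pos_eq; lra.
Qed.

Lemma k_eq (w : C) : w <> 0%C -> k w = (f w + g (/ w) - 1)%C.
Proof.
  intros Hw. unfold k, k_fun, CSeriesZ.
  rewrite (CSeries_unique _ (f w)).
  - rewrite (CSeries_unique _ (g (/ w) - 1)%C); [ring|].
    apply (is_series_ext (V := C_NormedModule) (fun n => a' (S n) * (/ w) ^ S n)%C).
    + intros n. now rewrite CpowZ_opp_of_nat, Cpow_inv.
    + apply (is_series_incr_1 (V := C_NormedModule) (fun n => a' n * (/ w) ^ n)%C).
      match goal with |- is_series _ ?l => replace l with (g (/ w)); [apply g_expansion|] end.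
      change (g (/ w) = g (/ w) - 1 + a' 0 * (/ w) ^ 0)%C. rewrite a'_0. simpl. ring.
  - apply (is_series_ext (V := C_NormedModule) (fun n => a n * w ^ n)%C).
    + intros n. now rewrite CpowZ_of_nat.
    + apply f_expansion.
Qed.

(** * Rescaling the circle of radius K^N to the unit circle *)

Let c (N : nat) : C := (eps ^ N * / RtoC K ^ N)%C.

Lemma c_neq_0 (N : nat) : c N <> 0%C.
Proof.
  apply Cmod_gt_0. unfold c. rewrite <- CpowZ_of_nat, <- CpowZ_opp_of_nat, Cmod_rotation.
  apply pow_lt; lra.
Qed.

Lemma CpowZ_rotation (N n : nat) :
  (CpowZ eps (Z.of_nat N * Z.of_nat n) * CpowZ K (- (Z.of_nat N * Z.of_nat n)) = c N ^ n)%C.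
Proof.
  rewrite <- Nat2Z.inj_mul, CpowZ_of_nat, CpowZ_opp_of_nat. unfold c.
  now rewrite Cpow_mult_l, Cpow_inv, !Cpow_mult_r by now apply Cpow_nz.
Qed.

Lemma a_shift (N n : nat) : a (N + n) = (a N * a n * c N ^ n)%C.
Proof.
  unfold a. rewrite Nat2Z.inj_add, A_coef_add, CpowZ_rotation by trivial. reflexivity.
Qed.

(** The addition law at -m produces the factor [c N] to the power -m; moved to the left, it leaves
    only natural exponents. *)
Lemma a_reflect (N m : nat) : (m <= N)%nat -> (a (N - m) * c N ^ m = a N * a' m)%C.
Proof.
  intros Hm. unfold a, a'. rewrite <- CpowZ_rotation, Nat2Z.inj_sub by trivial.
  unfold Z.sub. rewrite A_coef_add by trivial.
  set (x := (Z.of_nat N * Z.of_nat m)%Z).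
  replace (Z.of_nat N * - Z.of_nat m)%Z with (- x)%Z by (unfold x; ring).
  assert (He : (CpowZ eps (- x) * CpowZ eps x = 1)%C) by (rewrite <- CpowZ_add, Z.add_opp_diag_l by trivial; reflexivity).
  assert (HKx : (CpowZ K (- - x) * CpowZ K (- x) = 1)%C) by (rewrite <- CpowZ_add, Z.add_opp_diag_l by trivial; reflexivity).
  set (u := A_coef K eps _). set (v := A_coef K eps _).
  transitivity (u * v * ((CpowZ eps (- x) * CpowZ eps x) * (CpowZ K (- - x) * CpowZ K (- x))))%C; [ring|].
  rewrite He, HKx. ring.
Qed.

(** Indices from N on give [f] at w by [a_shift]; indices up to N, read backwards, give a partial
    sum of [g] at 1/w by [a_reflect]. Index N occurs in both, and 1 is subtracted. *)
Lemma f_rescaled (N : nat) (z : C) : z <> 0%C ->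
  f z = (a N * z ^ N * (f (c N * z) + psum a' N (/ (c N * z)) - 1))%C.
Proof.
  intros Hz. set (w := (c N * z)%C). assert (Hc := c_neq_0 N).
  assert (Hzn : forall n, (z ^ n)%C <> 0%C) by (intros; now apply Cpow_nz).
  assert (Hcn : forall n, (c N ^ n)%C <> 0%C) by (intros; now apply Cpow_nz).
  assert (Hw : w <> 0%C) by now apply Cmult_neq_0.
  (* The identity is exact for partial sums, the reflected half being already complete at n = 0;
     only the [f] half then has to converge. *)
  assert (Hpart : forall n, psum a (N + n) z
     = (a N * z ^ N * (psum a n w + psum a' N (/ w) - 1))%C).
  { induction n as [|n IH].
    - rewrite Nat.add_0_r. unfold psum at 2. rewrite csum_O, a_0.
      unfold psum. rewrite csum_rev.
      transitivity (csum (fun m => a N * z ^ N * (a' m * (/ w) ^ m))%C N).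
      + apply csum_ext. intros m Hm. rewrite Cpow_inv by trivial. unfold w. rewrite Cpow_mult_l.
        replace (a N * z ^ N * (a' m * / (c N ^ m * z ^ m)))%C
          with (a N * a' m * z ^ N * / (c N ^ m * z ^ m))%C by ring.
        rewrite <- a_reflect by trivial.
        replace N with (N - m + m)%nat at 5 by lia.
        rewrite Cpow_add_r. field. now split.
      + rewrite csum_mult_l. simpl. ring.
    - rewrite Nat.add_succ_r. unfold psum in *. rewrite !csum_S, IH.
      rewrite <- Nat.add_succ_r, a_shift, Cpow_add_r. unfold w. rewrite (Cpow_mult_l (c N) z (S n)). ring. }
  apply (is_cseries_unique (fun n => a n * z ^ n)%C); [apply f_expansion|].
  apply is_cseries_eps. intros eta Heta.
  set (s := Cmod (a N * z ^ N)%C). assert (Hs : 0 <= s) by apply Cmod_ge_0.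
  destruct (proj1 (is_cseries_eps _ _) (f_expansion w) (eta / (s + 1))) as [M HM].
  { apply Rdiv_lt_0_compat; lra. }
  exists (N + M)%nat. intros n Hn. replace n with (N + (n - N))%nat by lia.
  fold (psum a (N + (n - N)) z). rewrite Hpart.
  specialize (HM (n - N)%nat ltac:(lia)). fold (psum a (n - N) w) in HM.
  match goal with |- Cmod ?x < _ =>
    replace x with (a N * z ^ N * (psum a (n - N) w - f w))%C by ring end.
  rewrite Cmod_mult. fold s. apply Rlt_div_r in HM; [|lra].
  generalize (Cmod_ge_0 (psum a (n - N) w - f w)). nra.
Qed.

Lemma k_max_modulus :
  is_maximum (fun y => exists z, Cmod z = 1 /\ y = Cmod (k z)) A.
Proof.
  destruct (circle_maximum k 1 Rle_0_1) as [m Hm].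
  - intros t eta Heta.
    (* On the unit circle inversion is reflection of the angle, so continuity of g(1/w) reduces to
       that of [g] at the angle -t. *)
    assert (Hinv : forall s, (/ (1 * cis s) = cis (- s))%C).
    { intros s. assert (cis s <> 0%C) by (apply Cmod_gt_0; rewrite Cmod_cis; lra).
      transitivity (cis (- s) * cis s * / (1 * cis s))%C; [|field; trivial].
      rewrite <- cis_plus, Rplus_opp_l. unfold cis at 2. rewrite cos_0, sin_0.
      change (1, 0) with (RtoC 1). ring. }
    destruct (expansion_continuous a f f_expansion (cis t) (eta / 2) ltac:(lra)) as [d1 [Hd1 H1]].
    destruct (expansion_continuous a' g g_expansion (cis (- t)) (eta / 2) ltac:(lra)) as [d2 [Hd2 H2]].
    destruct (cis_continuous t d1 Hd1) as [e1 [He1 H1']].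
    destruct (cis_continuous (- t) d2 Hd2) as [e2 [He2 H2']].
    exists (Rmin e1 e2). split; [now apply Rmin_pos|]. intros s Hs.
    assert (Hl := Rmin_l e1 e2). assert (Hr := Rmin_r e1 e2).
    assert (Hnz : forall x, (1 * cis x)%C <> 0%C).
    { intros x. apply Cmod_gt_0. rewrite Cmult_1_l, Cmod_cis; lra. }
    rewrite !k_eq, !Hinv, !Cmult_1_l by apply Hnz.
    specialize (H1 (cis s) (H1' s ltac:(lra))).
    specialize (H2 (cis (- s))).
    assert (Hs2 : Rabs (- s - - t) < e2).
    { replace (- s - - t) with (- (s - t)) by ring. rewrite Rabs_Ropp. lra. }
    specialize (H2 (H2' _ Hs2)).
    match goal with |- Cmod ?x < _ => replace x with
      ((f (cis s) - f (cis t)) + (g (cis (- s)) - g (cis (- t))))%C by ring end.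
    eapply Rle_lt_trans; [apply Cmod_triangle|]. lra.
  - unfold A, A_max, max_modulus. fold k. now rewrite (maximum_unique _ m Hm).
Qed.

Lemma A_ge_0 : 0 <= A.
Proof. destruct k_max_modulus as [[z [_ ->]] _]. apply Cmod_ge_0. Qed.

(** The error is exactly [a N * z ^ N] times a tail of [g] at 1/w. As |1/w| = 1, that tail is small
    uniformly in z. *)
Lemma f_near_k (eta : R) : 0 < eta ->
  exists N0, forall N z, (N0 <= N)%nat -> Cmod z = K ^ N ->
    Cmod (c N * z) = 1 /\
    Cmod (f z - a N * z ^ N * k (c N * z)) <= Cmod (a N) * Cmod z ^ N * eta.
Proof.
  intros Heta. destruct (expansion_unif a' g 1 eta g_expansion Rle_0_1 Heta) as [N0 HN0].
  exists N0. intros N z HN Hz.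
  assert (HKN : 0 < K ^ N) by (apply pow_lt; lra).
  assert (Hz0 : z <> 0%C) by (apply Cmod_gt_0; lra).
  assert (Hw : Cmod (c N * z) = 1).
  { rewrite Cmod_mult. unfold c. rewrite <- CpowZ_of_nat, <- CpowZ_opp_of_nat, Cmod_rotation, Hz, pow_inv.
    field. lra. }
  assert (Hw0 : (c N * z)%C <> 0%C) by (apply Cmod_gt_0; lra).
  split; trivial.
  rewrite (f_rescaled N z Hz0), (k_eq _ Hw0).
  specialize (HN0 N (/ (c N * z))%C HN). rewrite Cmod_inv, Hw, Rinv_1 in HN0 by trivial.
  specialize (HN0 (Rle_refl 1)). set (w := (c N * z)%C) in *.
  match goal with |- Cmod ?x <= _ => replace x with
    (a N * z ^ N * - (g (/ w) - psum a' N (/ w)))%C by ring end.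
  rewrite !Cmod_mult, Cmod_opp, Cmod_pow.
  apply Rmult_le_compat_l; trivial.
  apply Rmult_le_pos; [apply Cmod_ge_0|apply pow_le, Cmod_ge_0].
Qed.

Lemma f_upper_bound (eta : R) : 0 < eta ->
  exists N0, forall N z, (N0 <= N)%nat -> K ^ N <= Cmod z <= K ^ S N ->
    Cmod (f z) <= Cmod (a N) * Cmod z ^ N * (A + eta).
Proof.
  intros Heta. destruct (f_near_k eta Heta) as [N0 HN0]. exists N0.
  assert (Hcirc : forall N z, (N0 <= N)%nat -> Cmod z = K ^ N ->
     Cmod (f z) <= Cmod (a N) * Cmod z ^ N * (A + eta)).
  { intros N z HN Hz. destruct (HN0 N z HN Hz) as [Hw H].
    assert (Hk : Cmod (k (c N * z)) <= A).
    { apply k_max_modulus. now exists (c N * z)%C. }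
    replace (f z) with (a N * z ^ N * k (c N * z) + (f z - a N * z ^ N * k (c N * z)))%C by ring.
    eapply Rle_trans; [apply Cmod_triangle|]. rewrite !Cmod_mult, Cmod_pow.
    assert (0 <= Cmod (a N) * Cmod z ^ N).
    { apply Rmult_le_pos; [apply Cmod_ge_0|apply pow_le, Cmod_ge_0]. }
    rewrite Rmult_plus_distr_l. apply Rplus_le_compat; trivial.
    now apply Rmult_le_compat_l. }
  intros N z HN Hz.
  assert (HA := A_ge_0). assert (Ha := Cmod_a_pos N).
  replace (Cmod (a N) * Cmod z ^ N * (A + eta)) with (Cmod (a N) * (A + eta) * Cmod z ^ N) by ring.
  apply (expansion_two_circles a f N (K ^ N) (K ^ S N)); trivial.
  - apply f_expansion.
  - apply pow_lt; lra.
  - apply Rmult_le_pos; lra.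
  - intros x [Hx|Hx].
    + specialize (Hcirc N x HN Hx). lra.
    + specialize (Hcirc (S N) x ltac:(lia) Hx).
      (* The tie of consecutive terms: |A_(N+1)| |x| = |A_N| on the outer circle. *)
      replace (Cmod (a (S N)) * Cmod x ^ S N) with (Cmod (a N) * Cmod x ^ N) in Hcirc; [lra|].
      assert (0 < K ^ S N) by (apply pow_lt; lra).
      rewrite Cmod_a_S, pow_inv, Hx.
      set (q := K ^ S N) in *. change (q ^ S N) with (q * q ^ N). field. lra.
Qed.

Lemma f_lower_bound (eta : R) : 0 < eta ->
  exists N0, forall N, (N0 <= N)%nat -> exists z, Cmod z = K ^ N /\
    Cmod (a N) * Cmod z ^ N * (A - eta) <= Cmod (f z).
Proof.
  intros Heta. destruct (f_near_k eta Heta) as [N0 HN0]. exists N0.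
  intros N HN. destruct k_max_modulus as [[w [Hw HAw]] _].
  assert (HKN : 0 < K ^ N) by (apply pow_lt; lra).
  assert (Hc := c_neq_0 N).
  assert (HcN : Cmod (c N) = / K ^ N).
  { unfold c. rewrite <- CpowZ_of_nat, <- CpowZ_opp_of_nat, Cmod_rotation. apply pow_inv. }
  (* A maximum point of |k| on the unit circle, carried back to the circle of radius K^N. *)
  exists (w / c N)%C.
  assert (Hz : Cmod (w / c N) = K ^ N).
  { rewrite Cmod_div, Hw, HcN by trivial. field. lra. }
  split; trivial. destruct (HN0 N (w / c N)%C HN Hz) as [_ H].
  set (z := (w / c N)%C) in *.
  assert (Ew : (c N * z)%C = w) by (unfold z; field; trivial). rewrite Ew in H.
  assert (Ht := Cmod_triangle (f z) (- (f z - a N * z ^ N * k w))).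
  replace (f z + - (f z - a N * z ^ N * k w))%C with (a N * z ^ N * k w)%C in Ht by ring.
  rewrite Cmod_opp, !Cmod_mult, Cmod_pow, <- HAw in Ht. lra.
Qed.

(** * Maximal term, lower limit and transcendence *)

Lemma f_max_term (N : nat) (r : R) : K ^ N <= r <= K ^ S N ->
  max_term r f = Cmod (a N) * r ^ N.
Proof.
  intros Hr. apply maximum_unique.
  assert (Hr0 : 0 < r) by (generalize (pow_lt K N ltac:(lra)); lra).
  (* Consecutive terms have ratio r / K^(n+1), at least 1 for n < N and at most 1 for n >= N, so the
     sequence of terms rises up to index N and then falls. *)
  assert (Hstep : forall n, Cmod (a (S n)) * r ^ S n = Cmod (a n) * r ^ n * (r / K ^ S n)).
  { intros n. rewrite Cmod_a_S, pow_inv. assert (HKn := pow_lt K (S n) ltac:(lra)).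
    set (q := K ^ S n) in *. change (r ^ S n) with (r * r ^ n). field. lra. }
  assert (Hpos : forall n, 0 < Cmod (a n) * r ^ n).
  { intros n. apply Rmult_lt_0_compat; [apply Cmod_a_pos|now apply pow_lt]. }
  split.
  - exists N. now rewrite (coef_expansion a f N f_expansion).
  - intros y [n ->]. rewrite (coef_expansion a f n f_expansion).
    destruct (Nat.le_ge_cases N n) as [Hn|Hn].
    + induction Hn as [|n Hn IH]; [lra|]. rewrite Hstep. specialize (Hpos n).
      assert (r / K ^ S n <= 1).
      { apply Rle_div_l; [apply pow_lt; lra|]. rewrite Rmult_1_l.
        apply Rle_trans with (K ^ S N); [lra|]. apply Rle_pow; [lra|lia]. }
      nra.
    + assert (Hdown : forall m, (m <= N)%nat -> Cmod (a (N - m)) * r ^ (N - m) <= Cmod (a N) * r ^ N).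
      { induction m as [|m IH]; intros Hm; [rewrite Nat.sub_0_r; lra|].
        specialize (IH ltac:(lia)). replace (N - m)%nat with (S (N - S m)) in IH by lia.
        rewrite Hstep in IH. specialize (Hpos (N - S m)%nat).
        assert (1 <= r / K ^ S (N - S m)).
        { apply Rle_div_r; [apply pow_lt; lra|]. rewrite Rmult_1_l.
          apply Rle_trans with (K ^ N); [|lra]. apply Rle_pow; [lra|lia]. }
        nra. }
      specialize (Hdown (N - n)%nat ltac:(lia)). now replace (N - (N - n))%nat with n in Hdown by lia.
Qed.

Lemma f_max_modulus_ge (N : nat) (r : R) : 0 <= r -> Cmod (a N) * r ^ N <= max_modulus r f.
Proof.
  intros Hr. apply (Cauchy_estimate a f r); trivial; [apply f_expansion|].
  intros z Hz. apply (expansion_max_modulus a f r f_expansion Hr). now exists z.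
Qed.

(** Obtained from the Cauchy estimate for [f], which forces the maximal term below the maximum
    modulus, in the limit eta -> 0. It makes the quotients meaningful and supplies 1 / A <= 1 for
    the estimates of the lower limit. *)
Lemma A_ge_1 : 1 <= A.
Proof.
  apply le_epsilon. intros eta Heta.
  destruct (f_upper_bound eta Heta) as [N HN].
  assert (HKN : 0 < K ^ N) by (apply pow_lt; lra).
  assert (H : Cmod (a N) * (K ^ N) ^ N <= Cmod (a N) * (K ^ N) ^ N * (A + eta)).
  { apply (Cauchy_estimate a f (K ^ N)); [apply f_expansion|lra|].
    intros z Hz. rewrite <- Hz. apply HN; [lia|]. rewrite Hz. simpl. nra. }
  assert (0 < Cmod (a N) * (K ^ N) ^ N).
  { apply Rmult_lt_0_compat; [apply Cmod_a_pos|now apply pow_lt]. }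
  apply Rmult_le_reg_l with (Cmod (a N) * (K ^ N) ^ N); lra.
Qed.

Lemma beta_f : beta f = Finite (1 / A).
Proof.
  assert (HA := A_ge_1).
  apply Rbar_LimInf_p_infty_eq.
  - intros eta Heta. destruct (f_upper_bound eta Heta) as [N0 HN0].
    exists (K ^ N0). intros r Hr.
    destruct (pow_bracket K r N0 HK ltac:(lra)) as [N [HN Hrange]].
    assert (Hr0 : 0 < r) by (generalize (pow_lt K N ltac:(lra)); lra).
    rewrite (f_max_term N r Hrange). set (mu := Cmod (a N) * r ^ N).
    assert (Hmu : 0 < mu) by (apply Rmult_lt_0_compat; [apply Cmod_a_pos|now apply pow_lt]).
    assert (Hge : mu <= max_modulus r f) by (apply f_max_modulus_ge; lra).
    assert (Hle : max_modulus r f <= mu * (A + eta)).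
    { destruct (expansion_max_modulus a f r f_expansion ltac:(lra)) as [[z [Hz E]] _].
      rewrite E. unfold mu. rewrite <- Hz. apply HN0; trivial. now rewrite Hz. }
    (* 1/A - eta <= 1/(A + eta), because eta (1/A) <= eta A when A >= 1. *)
    apply Rle_trans with (1 / (A + eta)).
    + apply Rle_div_r; [lra|].
      assert (E : (1 / A - eta) * (A + eta) = 1 + eta * (1 / A) - eta * A - eta * eta) by (field; lra).
      rewrite E. assert (1 / A <= 1) by (apply Rle_div_l; lra). nra.
    + assert (HM : 0 < max_modulus r f) by lra.
      apply (proj1 (Rle_div_r _ _ _ HM)).
      apply Rmult_le_reg_l with (A + eta); [lra|].
      replace ((A + eta) * (1 / (A + eta) * max_modulus r f)) with (max_modulus r f) by (field; lra).
      lra.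
  (* The bound 1/2 keeps A - e >= 1/2; then eta (A - e) >= eta/2 >= e >= e / A, which is what the
     final comparison needs. *)
  - intros eta r0 Heta. set (e := Rmin (1 / 2) (eta / 2)).
    assert (He : 0 < e) by (apply Rmin_pos; lra).
    assert (He1 : e <= 1 / 2) by apply Rmin_l. assert (He2 : e <= eta / 2) by apply Rmin_r.
    destruct (f_lower_bound e He) as [N0 HN0].
    destruct (Pow_x_infinity K ltac:(rewrite Rabs_pos_eq; lra) (r0 + 1)) as [m Hm].
    specialize (Hm (N0 + m)%nat ltac:(lia)). rewrite Rabs_pos_eq in Hm by (apply pow_le; lra).
    set (N := (N0 + m)%nat) in *. exists (K ^ N). split; [lra|].
    destruct (HN0 N ltac:(lia)) as [z [Hz Hlow]].
    assert (Hr0 : 0 < K ^ N) by (apply pow_lt; lra).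
    rewrite (f_max_term N (K ^ N)) by (simpl; nra). rewrite Hz in Hlow.
    set (mu := Cmod (a N) * (K ^ N) ^ N) in *.
    assert (Hmu : 0 < mu) by (apply Rmult_lt_0_compat; [apply Cmod_a_pos|now apply pow_lt]).
    assert (Hge : mu * (A - e) <= max_modulus (K ^ N) f).
    { eapply Rle_trans; [exact Hlow|].
      apply (expansion_max_modulus a f (K ^ N) f_expansion ltac:(lra)). now exists z. }
    assert (0 < mu * (A - e)) by (apply Rmult_lt_0_compat; lra).
    apply Rle_div_l; [lra|].
    apply Rle_trans with ((1 / A + eta) * (mu * (A - e))).
    + assert (E : (1 / A + eta) * (A - e) = 1 + eta * (A - e) - e * (1 / A)) by (field; lra).
      assert (1 / A <= 1) by (apply Rle_div_l; lra).
      assert (1 <= (1 / A + eta) * (A - e)) by (rewrite E; nra).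
      nra.
    + apply Rmult_le_compat_l; trivial.
      assert (0 < 1 / A) by (apply Rdiv_lt_0_compat; lra). lra.
Qed.

Lemma f_transcendental : transcendental_entire f.
Proof.
  split; [exact (expansion_entire a f f_expansion)|].
  intros [p [d Hp]].
  (* A polynomial padded with zeros is an expansion, so uniqueness would make the coefficient of
     index d + 1 vanish, whereas no [a n] is zero. *)
  assert (Hexp : is_expansion (fun n => if le_dec n d then p n else 0%C) f).
  { intros z. apply is_cseries_eps. intros eta Heta. exists d. intros n Hn.
    replace (csum (fun n0 => (if le_dec n0 d then p n0 else 0) * z ^ n0)%C n) with (f z).
    - replace (f z - f z)%C with (RtoC 0) by ring. now rewrite Cmod_0.
    - rewrite Hp. fold (csum (fun n => p n * z ^ n)%C d).
      induction Hn as [|n Hn IH].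
      + apply csum_ext. intros i Hi. destruct (le_dec i d); [trivial|lia].
      + rewrite csum_S, <- IH. destruct (le_dec (S n) d); [lia|ring]. }
  assert (E := is_expansion_unique _ _ f Hexp f_expansion (S d)). simpl in E.
  destruct (le_dec (S d) d); [lia|].
  generalize (Cmod_a_pos (S d)). rewrite <- E, Cmod_0. lra.
Qed.

End Extremal.

Theorem theorem2p8 :
  forall (K : R) (eps : C), 1 < K -> Cmod eps = 1 ->
    beta (f_fun K eps) = Finite (1 / A_max K eps) /\
    Rbar_le (Finite (1 / A_max K eps)) B.
Proof.
  intros K eps HK Heps. assert (Hbeta := beta_f K eps HK Heps). split; trivial.
  apply (proj1 (proj2_sig (Rbar_ex_lub _))). exists (f_fun K eps). split; [now apply f_transcendental|now symmetry].
Qed.
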